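(* (1) Let $B$ be the parallelogram $P(m_1,m_2)$, where $m_1,m_2\ge 3$ and $\max\{m_1,m_2\}\ge 4$. Then the number of connected components of $puz[B(2)]$ containing non-isolated configurations is $4\binom{m_1m_2-2}{2}$. (2) Let $B$ be the triangle $T(m)$ where $m\ge 5$. Then the number of connected components of $puz[B(2)]$ containing non-isolated configurations is $12\binom{m(m+1)/2-2}{3}$.
   Context: Hexagons of the regular hexagonal tessellation of the plane are identified with points of $\mathbb{Z}^2$; two hexagons are adjacent (share an edge) iff their difference is one of $\pm(1,0),\pm(0,1),\pm(1,1)$. A board $B$ is a finite set of hexagons (positions). The parallelogram board is $P(m_1,m_2)=\{0,\dots,m_1-1\}\times\{0,\dots,m_2-1\}$; the triangular board with $m$ hexagons on a side is $T(m)=\{(i,j): 0\le j\le i\le m-1\}$. $B(h)$ denotes the board $B$ with $h$ holes: a configuration of $B(h)$ is a placement of $t=|B|-h$ tiles with distinct labels $1,\dots,t$ on distinct positions of $B$; the $h$ unoccupied positions are the holes (unlabeled; adjacent holes are counted separately). A slide moves a tile from its position $p$ to a hole $q$ adjacent to $p$, and is permitted iff there is another hole $r$ that is adjacent to both $p$ and $q$. The puzzle graph $puz[B(h)]$ has the configurations of $B(h)$ as vertices, with an edge between two configurations whenever one can be obtained from the other by one slide. A configuration is non-isolated if at least one slide is possible from it. *)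

(* Defs.v *)
From mathcomp Require Import all_boot all_order all_algebra.
From mathcomp Require Import finmap.

Set Implicit Arguments.
Unset Strict Implicit.
Unset Printing Implicit Defensive.

Import GRing.Theory.
Local Open Scope ring_scope.
Local Open Scope fset_scope.

Definition hex : Type := (int * int)%type.

Definition hex_adj (p q : hex) : bool :=
  q - p \in [:: (1, 0); (-1, 0); (0, 1); (0, -1); (1, 1); (-1, -1)].

Definition board : Type := {fset hex}.

Definition parallelogram (m1 m2 : nat) : board :=
  [fset (i%:Z, j%:Z) | i in iota 0 m1, j in iota 0 m2].

Definition triangle (m : nat) : board :=
  [fset (i%:Z, j%:Z) | i in iota 0 m, j in iota 0 i.+1].

(* A tile labelled k.+1 is represented by the ordinal k. *)
Definition tile (B : board) (h : nat) : finType := 'I_(#|` B| - h).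

Definition config (B : board) (h : nat) : finType :=
  {c : {ffun tile B h -> B} | injectiveb c}.

Section Puzzle.

Variables (B : board) (h : nat).

Definition hole (c : config B h) (q : B) : bool :=
  q \notin codom (val c).

Definition slide_permitted (c : config B h) (p q : B) : bool :=
  [&& hole c q, hex_adj (val p) (val q) &
      [exists r : B, [&& r != q, hole c r, hex_adj (val r) (val p)
                       & hex_adj (val r) (val q)]]].

Definition slide (c d : config B h) : bool :=
  [exists a : tile B h,
    slide_permitted c (val c a) (val d a) &&
    [forall b : tile B h, (b != a) ==> (val d b == val c b)]].

Definition puz : rel (config B h) := fun c d => slide c d || slide d c.

Definition non_isolated (c : config B h) : bool := [exists d, slide c d].

Definition component (c : config B h) : {set config B h} :=
  [set d | connect puz c d].

Definition non_isolated_components : {set {set config B h}} :=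
  [set component c | c in non_isolated].

End Puzzle.

(* Main.v *)
Require Import Defs.
From mathcomp Require Import all_boot all_order all_algebra all_fingroup finmap.
From mathcomp Require Import zify.

Set Implicit Arguments.
Unset Strict Implicit.
Unset Printing Implicit Defensive.

Import Order.TTheory GRing.Theory Num.Theory.

(** With two holes, a slide requires the holes to be adjacent: the moving tile
completes them to a triangle of cells, and the pair of holes passes from one
side of this triangle to another. From every non-isolated configuration the
holes can be walked to one fixed side {v0, v1} between two interior cells
([non_isolated_base]), so it suffices to count the components among the
configurations that have their holes there. The permutations of the remaining
cells act simply transitively on these configurations, and two of them are
connected iff they differ by an element of the group [loops v0 v1] of the
permutations that closed walks of the holes produce. The number of components
is thus the index of this group ([card_components]).

The group is not larger than stated below by [connect_invariant]. The three
directions (1,0), (0,1) and (-1,-1) turn every triangle of cells into a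
directed cycle. When the two holes are told apart as source and target of
their side, a slide is a three-cycle on the tile and the two holes of its
triangle; hence closed walks give even permutations. Moreover a cell with only
two neighbours lies in a single triangle, and its tile is back in place
whenever the holes leave that triangle; hence closed walks fix these corners.

The group is as large as that allows by [cyc3_on_covered]. Leading one hole
around the other gives a five-cycle on the five tiles of a hexagon. If both
holes are interior, there are two such five-cycles s and t on eight cells, with
two adjacent cells in common, and the fifth power of s t s is a three-cycle;
so the group has all three-cycles on the eight cells ([two_five_cycles]). A
slide conjugates the group of closed walks ([loopsJ]), and three-cycles on two
overlapping sets generate those on the union ([cyc3_onU]), so a walk through
all interior cells yields every three-cycle on the cells that are interior or
adjacent to an interior cell. Only the acute corners of the board are missed.

With n tiles and k acute corners the group is therefore the alternating group
on n - k cells, of index 2 n! / (n - k)! in the symmetric group on n cells. The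
parallelogram has k = 2, which gives 4 'C(n, 2), and the triangle has k = 3,
which gives 12 'C(n, 3). *)

(** * Three-cycles in a permutation group *)

(** Bookkeeping for points in general position: [distinct_hyps] turns a
hypothesis such as [uniq] into one inequality for each pair, and [distinct]
closes goals of this kind from these, in either orientation. *)

Ltac distinct1 :=
  match goal with
  | H : is_true (?a != ?b) |- is_true (?a != ?b) => exact H
  | H : is_true (?b != ?a) |- is_true (?a != ?b) => rewrite eq_sym; exact H
  | |- is_true true => exact isT
  end.
Ltac distinct := rewrite /= ?inE ?negb_or -?andbA ?andbT;
  repeat (apply/andP; split); distinct1.
Ltac distinct_hyps := rewrite /= ?inE ?negb_or -?andbA ?andbT;
  repeat (case/andP=> ?); move=> ?.

Section ThreeCycles.
Local Open Scope group_scope.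
Variable T : finType.
Implicit Types (a b c d p q x y z : T) (s t u : {perm T}) (A B : {set T}).

Definition cyc3 a b c : {perm T} := tperm a b * tperm a c.

Lemma cyc3P s a b c :
  uniq [:: a; b; c] -> s a = b -> s b = c -> s c = a ->
  (forall z, z \notin [:: a; b; c] -> s z = z) -> s = cyc3 a b c.
Proof.
rewrite /= !inE => /and3P[/norP[nab nac] nbc _] sa sb sc sz.
apply/permP=> z; rewrite permM.
case: (eqVneq z a) => [->|nza]; first by rewrite tpermL tpermD // eq_sym.
case: (eqVneq z b) => [->|nzb]; first by rewrite tpermR tpermL.
rewrite [tperm a b z]tpermD 1?eq_sym //.
case: (eqVneq z c) => [->|nzc]; first by rewrite tpermR.
by rewrite tpermD 1?eq_sym // sz // !inE !negb_or nza nzb.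
Qed.

Lemma cyc3E a b c : uniq [:: a; b; c] ->
  [/\ cyc3 a b c a = b, cyc3 a b c b = c, cyc3 a b c c = a
    & forall z, z \notin [:: a; b; c] -> cyc3 a b c z = z].
Proof.
rewrite /= !inE => /and3P[/norP[nab nac] nbc _]; split; rewrite ?permM.
- by rewrite tpermL tpermD // eq_sym.
- by rewrite tpermR tpermL.
- by rewrite [tperm a b c]tpermD // tpermR.
by move=> z; rewrite !inE => /norP[? /norP[? ?]]; rewrite permM !tpermD // eq_sym.
Qed.

Lemma cyc3J a b c s : cyc3 a b c ^ s = cyc3 (s a) (s b) (s c).
Proof. by rewrite /cyc3 conjMg !tpermJ. Qed.

Lemma cyc3V a b c : (cyc3 a b c)^-1 = cyc3 a c b.
Proof. by rewrite /cyc3 invMg !tpermV. Qed.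

Lemma cyc3_rot a b c : uniq [:: a; b; c] -> cyc3 b c a = cyc3 a b c.
Proof.
move=> U; have [ea eb ec ez] := cyc3E U.
apply/esym/cyc3P => //; first by move: U; distinct_hyps; distinct.
by move=> z; rewrite -[[:: b; c; a]]/(rot 1 [:: a; b; c]) mem_rot; exact: ez.
Qed.

Lemma odd_cyc3 a b c : uniq [:: a; b; c] -> odd_perm (cyc3 a b c) = false.
Proof.
rewrite /= !inE => /and3P[/norP[nab nac] nbc _].
by rewrite odd_permM !odd_tperm nab nac.
Qed.

Definition cyc3_on A (H : {set {perm T}}) :=
  forall a b c, a \in A -> b \in A -> c \in A -> uniq [:: a; b; c] ->
  cyc3 a b c \in H.

Lemma cyc3_onS A B (H : {set {perm T}}) : B \subset A -> cyc3_on A H -> cyc3_on B H.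
Proof. by move=> /subsetP sBA hA a b c /sBA aA /sBA bA /sBA cA; exact: hA. Qed.

Lemma cyc3_onJ A s (H K : {group {perm T}}) :
  (forall u, u \in H -> u ^ s \in K) -> cyc3_on A H -> cyc3_on (s @: A) K.
Proof.
move=> sHK hA _ _ _ /imsetP[a aA ->] /imsetP[b bA ->] /imsetP[c cA ->] U.
rewrite -cyc3J; apply/sHK/hA => //.
move: U; rewrite -[[:: s a; _; _]]/(map s [:: a; b; c]) map_inj_uniq //.
exact: perm_inj.
Qed.

Variable H : {group {perm T}}.

Lemma mem_cyc3V a b c : (cyc3 a c b \in H) = (cyc3 a b c \in H).
Proof. by rewrite -cyc3V groupV. Qed.

(** Conjugating (p q c) by (p q d) gives (q d c), and conjugating (p c d) by
the inverse of (p q e) gives (e c d); so the three-cycles through p and q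
generate all the others. *)
Lemma cyc3_on_pencil A p q : p != q ->
  (forall c, c \in A -> c != p -> c != q -> cyc3 p q c \in H) -> cyc3_on A H.
Proof.
move=> npq hpq.
have hqp c : c \in A -> c != p -> c != q -> cyc3 q p c \in H.
  move=> cA ncp ncq; rewrite -mem_cyc3V -cyc3_rot; last by distinct.
  by rewrite -cyc3_rot ?hpq //; distinct.
have half x y : x != y ->
    (forall c, c \in A -> c != x -> c != y -> cyc3 x y c \in H) ->
    forall c d, c \in A -> d \in A -> c != x -> c != y -> d != x -> d != y ->
    c != d -> cyc3 y d c \in H.
  move=> nxy hxy c d cA dA ncx ncy ndx ndy ncd.
  have U : uniq [:: x; y; d] by distinct.
  have [ex ey _ ez] := cyc3E U.
  have -> : cyc3 y d c = cyc3 x y c ^ cyc3 x y d.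
    by rewrite cyc3J ex ey ez //; distinct.
  by apply: groupJ; apply: hxy.
have hq := half p q npq hpq.
have hp : forall c d, c \in A -> d \in A -> c != p -> c != q -> d != p ->
    d != q -> c != d -> cyc3 p d c \in H.
  move=> c d cA dA ? ? ? ? ?; apply: (half q p) => //; rewrite 1?eq_sym //.
  by move=> e *; exact: hqp.
(* triples that avoid both p and q *)
have h0 c d e : c \in A -> d \in A -> e \in A -> uniq [:: p; q; c; d; e] ->
    cyc3 e c d \in H.
  move=> cA dA eA; distinct_hyps.
  have U : uniq [:: p; q; e] by distinct.
  have [ep eq ee ez] := cyc3E U.
  have -> : cyc3 e c d = cyc3 p c d ^ (cyc3 p q e)^-1.
    have Vp : (cyc3 p q e)^-1 p = e by apply: (canLR (permK _)); rewrite ee.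
    have fixV z : z \notin [:: p; q; e] -> (cyc3 p q e)^-1 z = z.
      by move=> /ez {1}<-; rewrite permK.
    by rewrite cyc3J Vp !fixV //; distinct.
  apply: groupJ; last by rewrite groupV; apply: hpq; rewrite // eq_sym.
  by apply: hp; rewrite // eq_sym.
(* triples that start with x, where y is the other one of p and q *)
have via x y : x != y ->
    (forall c, c \in A -> c != x -> c != y -> cyc3 x y c \in H) ->
    (forall c d, c \in A -> d \in A -> c != x -> c != y -> d != x -> d != y ->
       c != d -> cyc3 x d c \in H) ->
    forall c d, c \in A -> d \in A -> uniq [:: x; c; d] -> cyc3 x c d \in H.
  move=> nxy hxy hx c d cA dA; distinct_hyps.
  case: (eqVneq c y) => [Ec|ncy].
    by rewrite Ec; apply: hxy; rewrite // -?Ec eq_sym.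
  case: (eqVneq d y) => [->|ndy].
    by rewrite mem_cyc3V; apply: hxy; rewrite // eq_sym.
  by apply: hx; rewrite // eq_sym.
have viaP := via p q npq hpq hp.
have viaQ : forall c d, c \in A -> d \in A -> uniq [:: q; c; d] -> cyc3 q c d \in H.
  apply: (via q p) => [|c cA ? ?|c d cA dA ? ? ? ? ?]; first by rewrite eq_sym.
    exact: hqp.
  exact: hq.
move=> a b c aA bA cA U.
have Ub : uniq [:: b; c; a] by move: U; distinct_hyps; distinct.
have Uc : uniq [:: c; a; b] by move: U; distinct_hyps; distinct.
have rotb : cyc3 b c a = cyc3 a b c by apply: cyc3_rot.
have rotc : cyc3 c a b = cyc3 a b c by rewrite -rotb cyc3_rot.
case: (eqVneq a p) U => [->|nap] U; first exact: viaP.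
case: (eqVneq a q) U => [->|naq] U; first exact: viaQ.
case: (eqVneq b p) Ub rotb => [->|nbp] Ub rotb; first by rewrite -rotb viaP.
case: (eqVneq b q) Ub rotb => [->|nbq] Ub rotb; first by rewrite -rotb viaQ.
case: (eqVneq c p) Uc rotc => [->|ncp] Uc rotc; first by rewrite -rotc viaP.
case: (eqVneq c q) Uc rotc => [->|ncq] Uc rotc; first by rewrite -rotc viaQ.
by apply: h0 => //; move: U; distinct_hyps; distinct.
Qed.

(** A three-cycle through two fixed common points has its third point in A or
in B, so the pencil of the two common points is available. *)
Lemma cyc3_onU A B p q : p != q -> p \in A :&: B -> q \in A :&: B ->
  cyc3_on A H -> cyc3_on B H -> cyc3_on (A :|: B) H.
Proof.
rewrite !inE => npq /andP[pA pB] /andP[qA qB] hA hB.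
apply: (cyc3_on_pencil npq) => c cAB ncp ncq.
have U : uniq [:: p; q; c] by distinct.
by case/setUP: cAB => cX; [apply: hA | apply: hB].
Qed.

(** Following s by a three-cycle that brings s a back to a fixes a without
moving any new point, so the support shrinks. This needs a third point of the
support: if there is none then s is a transposition, which is odd. *)
Lemma cyc3_on_even A s : cyc3_on A H -> perm_on A s -> ~~ odd_perm s -> s \in H.
Proof.
move=> hA; have [n] := ubnP #|[set x | s x != x]|; elim: n s => // n IHn s.
set D := [set x | s x != x] => ltDn onA ev.
have DA x : x \in D -> x \in A by rewrite inE => /(subsetP onA).
have [D0|[a aD]] := set_0Vmem D.
  suff -> : s = 1 by apply: group1.
  apply/permP=> x; rewrite perm1; apply/eqP/negPn/negP => nx.
  have: x \in D by rewrite inE.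
  by rewrite D0 inE.
have nba : s a != a by move: aD; rewrite inE.
have bD : s a \in D by rewrite inE (inj_eq perm_inj).
have [c cD /norP[nca ncb]] : exists2 c, c \in D & ~~ ((c == a) || (c == s a)).
  have [/exists_inP //|/exists_inPn noc] :=
    boolP [exists c in D, ~~ ((c == a) || (c == s a))].
  have sV : s (s a) = a.
    have: s (s a) \in D by rewrite inE !(inj_eq perm_inj).
    move/noc; rewrite negbK (inj_eq perm_inj) (negPf nba) orbF.
    by move/eqP.
  case/negP: ev; suff -> : s = tperm a (s a) by rewrite odd_tperm eq_sym.
  apply/permP=> x; case: tpermP => [->|->|xa xb] //.
  apply/eqP/negPn/negP=> nx; have /noc : x \in D by rewrite inE.
  by rewrite negbK => /orP[] /eqP.
have U : uniq [:: s a; a; c] by distinct.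
have [eb ea ec ez] := cyc3E U.
have kH : cyc3 (s a) a c \in H by apply: hA; rewrite ?DA.
rewrite -(groupMr _ kH); set k := cyc3 _ _ _ in eb ea ec ez kH *.
have kfix z : z \notin D -> k z = z.
  move=> zD; apply: ez; rewrite !inE !negb_or.
  by apply/and3P; split; apply: contraNneq zD => ->.
apply: IHn.
- rewrite -ltnS; apply: leq_trans ltDn; rewrite ltnS; apply: proper_card.
  apply/properP; split; last by exists a; rewrite ?inE // permM eb eqxx.
  apply/subsetP=> x; apply: contraTT => xD; rewrite inE negbK permM.
  by move: (xD); rewrite inE negbK => /eqP ->; rewrite kfix.
- apply: perm_onM => //; apply/subsetP=> x; rewrite inE => kx; apply: DA.
  by apply: contraNT kx => /kfix ->.
by rewrite odd_permM odd_cyc3 // addbF.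
Qed.


(** The product s * t * s is (x y a2) times the disjoint five-cycle
(b1 a3 a1 b3 b2), so its fifth power is the square of (x y a2). *)
Lemma five_cycles_word x y a1 a2 a3 b1 b2 b3 s t :
    uniq [:: x; y; a1; a2; a3; b1; b2; b3] ->
    map s [:: x; y; a3; a2; a1] = [:: y; a3; a2; a1; x] ->
    map t [:: y; x; b3; b2; b1] = [:: x; b3; b2; b1; y] ->
    (forall z, z \notin [:: x; y; a3; a2; a1] -> s z = z) ->
    (forall z, z \notin [:: y; x; b3; b2; b1] -> t z = z) ->
  (s * t * s) ^+ 5 = cyc3 x a2 y.
Proof.
move=> U [sx sy sa3 sa2 sa1] [ty tx tb3 tb2 tb1] sz tz.
move: (U); distinct_hyps.
have [Ub Ua] : all (fun z => s z == z) [:: b1; b2; b3]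
  /\ all (fun z => t z == z) [:: a1; a2; a3].
  by split; rewrite /= ?sz ?tz ?eqxx //; distinct.
move: Ub Ua => /= /and4P[/eqP sb1 /eqP sb2 /eqP sb3 _].
move=> /and4P[/eqP ta1 /eqP ta2 /eqP ta3 _].
have stE := (sx, sy, sa1, sa2, sa3, tx, ty, tb1, tb2, tb3,
  sb1, sb2, sb3, ta1, ta2, ta3).
have E z : ((s * t * s) ^+ 5) z = iter 5 (fun z => s (t (s z))) z.
  by rewrite !expgS expg0 mulg1 !permM.
apply: cyc3P; rewrite ?E /= ?stE //.
  by distinct.
move=> z zn; rewrite E /=.
case: (boolP (z \in [:: a1; a3; b1; b2; b3])) => [|zN].
  by rewrite !inE => /or4P[|||/orP[]] /eqP ->; rewrite !stE.
move: zn zN; rewrite !inE !negb_or => /and3P[zx za2 zy] /and5P[za1 za3 zb1 zb2 zb3].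
have szz : s z = z by apply: sz; distinct.
have tzz : t z = z by apply: tz; distinct.
by do 5!rewrite szz tzz szz.
Qed.

(** The words s t s and t s t give the three-cycles on {x, y, a2} and on
{x, y, b2}. The images of {x, y, a2, b2} under s and under t cover the other
points, and each meets what is already reached in two points. *)
Lemma two_five_cycles x y a1 a2 a3 b1 b2 b3 s t :
    uniq [:: x; y; a1; a2; a3; b1; b2; b3] -> s \in H -> t \in H ->
    map s [:: x; y; a3; a2; a1] = [:: y; a3; a2; a1; x] ->
    map t [:: y; x; b3; b2; b1] = [:: x; b3; b2; b1; y] ->
    (forall z, z \notin [:: x; y; a3; a2; a1] -> s z = z) ->
    (forall z, z \notin [:: y; x; b3; b2; b1] -> t z = z) ->
  cyc3_on [set z in [:: x; y; a1; a2; a3; b1; b2; b3]] H.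
Proof.
move=> U sH tH Es Et sz tz.
have kH : cyc3 x a2 y \in H.
  by rewrite -(five_cycles_word U Es Et sz tz) groupX // !groupM.
have kH' : cyc3 y b2 x \in H.
  have U' : uniq [:: y; x; b1; b2; b3; a1; a2; a3].
    by move: U; distinct_hyps; distinct.
  by rewrite -(five_cycles_word U' Et Es tz sz) groupX // !groupM.
move: (U); distinct_hyps; case: Es Et => sx sy sa3 sa2 sa1 [ty tx tb3 tb2 tb1].
have h1 : cyc3_on [set x; y; a2; b2] H.
  apply: (@cyc3_on_pencil _ x y) => // c; rewrite !inE -!orbA.
  case/or4P=> /eqP -> //; rewrite ?eqxx // => _ _.
    by rewrite mem_cyc3V.
  by rewrite -cyc3_rot //; distinct.
have sb2 : s b2 = b2 by apply: sz; distinct.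
have ta2 : t a2 = a2 by apply: tz; distinct.
have h2 : cyc3_on [set y; a3; a1; b2] H.
  apply: cyc3_onS (cyc3_onJ _ h1 (s := s) (K := H)) => [|u uH]; last by rewrite groupJ.
  apply/subsetP=> z; rewrite !inE -!orbA => /or4P[] /eqP ->; apply/imsetP.
  - by exists x; rewrite ?inE ?eqxx ?orbT.
  - by exists y; rewrite ?inE ?eqxx ?orbT.
  - by exists a2; rewrite ?inE ?eqxx ?orbT.
  by exists b2; rewrite ?inE ?eqxx ?orbT.
have h3 : cyc3_on [set x; b3; b1; a2] H.
  apply: cyc3_onS (cyc3_onJ _ h1 (s := t) (K := H)) => [|u uH]; last by rewrite groupJ.
  apply/subsetP=> z; rewrite !inE -!orbA => /or4P[] /eqP ->; apply/imsetP.
  - by exists y; rewrite ?inE ?eqxx ?orbT.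
  - by exists x; rewrite ?inE ?eqxx ?orbT.
  - by exists b2; rewrite ?inE ?eqxx ?orbT.
  by exists a2; rewrite ?inE ?eqxx ?orbT.
have n1 : y != b2 by []. have n2 : x != a2 by [].
have := cyc3_onU n2 _ _ (cyc3_onU n1 _ _ h1 h2) h3.
rewrite !inE !eqxx !orbT => /(_ isT isT isT isT).
apply: cyc3_onS; apply/subsetP=> z; rewrite !inE.
by do ![case: (z == _) => //=].
Qed.
End ThreeCycles.

(** * Oriented triangles of hexagons *)

Section HexPlane.
Local Open Scope ring_scope.
Implicit Types (p q r : hex).

(** The steps (1,0), (0,1) and (-1,-1) add up to zero: they run once around a
triangle. *)
Definition hex_pos p q : bool := q - p \in [:: (1, 0); (0, 1); (-1, -1) : hex].

Lemma hex_adjE p q : hex_adj p q = hex_pos p q || hex_pos q p.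
Proof.
rewrite /hex_pos /hex_adj -(opprB q p); case: (q - p) => a b.
rewrite !inE /eq_op /=; lia.
Qed.

Lemma hex_adjC p q : hex_adj p q = hex_adj q p.
Proof. by rewrite !hex_adjE orbC. Qed.

Lemma hex_adjxx p : hex_adj p p = false.
Proof. by rewrite /hex_adj subrr. Qed.

Lemma hex_pos_asym p q : hex_pos p q -> hex_pos q p = false.
Proof.
rewrite /hex_pos -(opprB q p); case: (q - p) => a b.
rewrite !inE /eq_op /=; lia.
Qed.

Lemma hex_pos_triangle p q r :
  hex_pos p q -> hex_adj q r -> hex_adj p r -> hex_pos q r && hex_pos r p.
Proof.
have E : r - p = (q - p) + (r - q) by rewrite [RHS]addrC subrKA.
rewrite /hex_pos /hex_adj -(opprB r p) E {E}.
case: (q - p) (r - q) => [a b] [c d].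
rewrite !inE /eq_op /=; lia.
Qed.
End HexPlane.

(** * Slides and closed walks of the holes *)

Section Moves.
Variable B : board.
Local Notation cfg := (config B 2).
Implicit Types (p q r x y z : B) (c d : cfg) (s t u : {perm B}).
Local Open Scope group_scope.

Definition adj p q := hex_adj (val p) (val q).
Definition pos p q := hex_pos (val p) (val q).

Lemma adjE p q : adj p q = pos p q || pos q p. Proof. exact: hex_adjE. Qed.
Lemma adjC p q : adj p q = adj q p. Proof. exact: hex_adjC. Qed.
Lemma adj_neq p q : adj p q -> p != q.
Proof. by apply: contraTneq => ->; rewrite /adj hex_adjxx. Qed.

Definition tri p q r := [&& adj p q, adj q r & adj p r].

Lemma tri_rot p q r : tri p q r = tri q r p.
Proof.
rewrite /tri (adjC r p) (adjC q p).
by case: (adj p q); case: (adj q r); case: (adj p r).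
Qed.

Lemma tri_swap p q r : tri p q r = tri q p r.
Proof. by rewrite /tri (adjC q p); case: (adj q r); case: (adj p r). Qed.

Lemma tri_neq p q r : tri p q r -> [/\ p != q, q != r & p != r].
Proof. by case/and3P => /adj_neq ? /adj_neq ? /adj_neq ?. Qed.

Lemma pos_triangle p q r : tri p q r -> pos p q -> pos q r /\ pos r p.
Proof. by case/and3P=> _ qr pr pq; apply/andP; exact: hex_pos_triangle. Qed.

(** The right action of the permutations of the cells on configurations: s
moves the tile at cell x, if any, to cell s x. *)
Definition place c s : cfg.
Proof.
exists [ffun a => s (val c a)].
by apply/injectiveP => a b; rewrite !ffunE => /perm_inj /(injectiveP _ (valP c)).
Defined.

Lemma placeE c s a : val (place c s) a = s (val c a).
Proof. by rewrite ffunE. Qed.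

Lemma cfg_inj c : injective (val c). Proof. exact/injectiveP/(valP c). Qed.

Lemma cfgP c d : (forall a, val c a = val d a) -> c = d.
Proof. by move=> E; apply/val_inj/ffunP. Qed.

Lemma place1 c : place c 1 = c.
Proof. by apply: cfgP => a; rewrite placeE perm1. Qed.

Lemma placeM c s t : place c (s * t) = place (place c s) t.
Proof. by apply: cfgP => a; rewrite !placeE permM. Qed.

Lemma hole_place c s p : hole (place c s) (s p) = hole c p.
Proof.
congr (~~ _); apply/codomP/codomP => [[a]|[a ->]]; last by exists a; rewrite placeE.
by rewrite placeE => /perm_inj ->; exists a.
Qed.

Lemma eq_place c s t : (forall p, ~~ hole c p -> s p = t p) -> place c s = place c t.
Proof.
move=> E; apply: cfgP => a; rewrite !placeE; apply: E.
by rewrite negbK codom_f.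
Qed.

Definition holes c q r := [/\ q != r & forall x, hole c x = (x == q) || (x == r)].

Lemma holesC c q r : holes c q r -> holes c r q.
Proof. by case=> nqr E; split=> [|x]; [rewrite eq_sym | rewrite E orbC]. Qed.

Lemma holes_place c s q r : holes c q r -> holes (place c s) (s q) (s r).
Proof.
case=> nqr E; split; first by rewrite (inj_eq perm_inj).
by move=> x; rewrite -(permKV s x) hole_place E !(inj_eq perm_inj).
Qed.

Lemma holesP c q r : 2 <= #|`B| -> q != r -> hole c q -> hole c r -> holes c q r.
Proof.
move=> B2 nqr hq hr; split=> // x.
have S : [set q; r] \subset [set x | hole c x].
  by apply/subsetP=> y; rewrite !inE => /orP[] /eqP ->.
have : [set q; r] == [set x | hole c x].
  rewrite eqEcard S cards2 nqr /=.
  have -> : [set x | hole c x] = ~: [set x in codom (val c)].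
    by apply/setP=> y; rewrite !inE.
  rewrite cardsCs setCK cardsE card_codom; last exact: cfg_inj.
  by rewrite card_ord -cardfE subKn.
by move/eqP/setP/(_ x); rewrite !inE.
Qed.

Lemma board2 q r : q != r -> 2 <= #|`B|.
Proof.
move=> nqr; rewrite cardfE; have := max_card (mem [set q; r]).
by rewrite cards2 nqr.
Qed.

Lemma slideP c d : reflect
  (exists p q r, [/\ tri p q r, holes c q r & d = place c (tperm p q)])
  (slide c d).
Proof.
apply: (iffP existsP) => [[a]|[p [q [r [T H ->]]]]].
  case/andP=> /and3P[hq pq /existsP[r /and4P[nrq hr rp rq]]] /forallP same.
  exists (val c a), (val d a), r; split.
  - by apply/and3P; split=> //; rewrite adjC.
  - by apply: holesP; rewrite // 1?eq_sym //; exact: board2 nrq.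
  apply: cfgP => b; rewrite placeE.
  case: (eqVneq b a) => [->|nba]; first by rewrite tpermL.
  have /implyP/(_ nba)/eqP -> := same b.
  rewrite tpermD //; first by rewrite (inj_eq (@cfg_inj c)) eq_sym.
  by apply: contraNneq hq => ->; exact: codom_f.
have [nqr hE] := H.
have [npq _ npr] := tri_neq T.
have /codomP[a pa] : p \in codom (val c).
  by rewrite -[_ \in _]negbK -/(hole c p) hE negb_or npq.
have da : val (place c (tperm p q)) a = q by rewrite placeE -pa tpermL.
exists a; rewrite da -pa; apply/andP; split.
  apply/and3P; split; [by rewrite hE eqxx | by case/and3P: T |].
  apply/existsP; exists r; rewrite eq_sym nqr hE eqxx orbT /=.
  by case/and3P: T => _ qr pr; rewrite -!/(adj _ _) adjC pr adjC.
apply/forallP=> b; apply/implyP=> nba; rewrite placeE tpermD //.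
  by rewrite pa (inj_eq (@cfg_inj c)) eq_sym.
apply/eqP=> E; have : hole c q by rewrite hE eqxx.
by rewrite E /hole codom_f.
Qed.

(** The hole r that permits a slide stays where it is, and permits the reverse
slide. *)
Lemma slide_sym c d : slide c d = slide d c.
Proof.
suff h c' d' : slide c' d' -> slide d' c' by apply/idP/idP; exact: h.
case/slideP=> p [q [r [T H ->]]]; apply/slideP; exists q, p, r.
have [npq nqr npr] := tri_neq T.
split; first by rewrite tri_swap.
  by have := holes_place (tperm p q) H; rewrite tpermR tpermD.
by rewrite tpermC -placeM tperm2 place1.
Qed.

Lemma puzE c d : puz c d = slide c d.
Proof. by rewrite /puz [slide d c]slide_sym orbb. Qed.

Lemma connect_puzC c d : connect (@puz B 2) c d = connect (@puz B 2) d c.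
Proof. by apply: sym_connect_sym => x y; rewrite !puzE slide_sym. Qed.

Lemma slide_step p q r c : tri p q r -> holes c q r ->
  connect (@puz B 2) c (place c (tperm p q)) /\ holes (place c (tperm p q)) p r.
Proof.
move=> T H; have [npq nqr npr] := tri_neq T; split.
  by apply: connect1; rewrite puzE; apply/slideP; exists p, q, r.
by have := holes_place (tperm p q) H; rewrite tpermR tpermD.
Qed.

Lemma non_isolatedP c :
  reflect (exists p q r, tri p q r /\ holes c q r) (non_isolated c).
Proof.
apply: (iffP existsP) => [[d /slideP[p [q [r []]]]]|[p [q [r [T H]]]]].
  by exists p, q, r.
by exists (place c (tperm p q)); apply/slideP; exists p, q, r.
Qed.

(** The permutations that closed walks of the holes realise. Asking for the
same permutation at every configuration with these holes makes the set closed
under products. *)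
Definition loops q r : {set {perm B}} :=
  [set s : {perm B} | [&& s q == q, s r == r &
     [forall c, [forall x, hole c x == ((x == q) || (x == r))] ==>
        connect (@puz B 2) c (place c s)]]].

Lemma loopsP q r s : q != r -> reflect
  [/\ s q = q, s r = r & forall c, holes c q r -> connect (@puz B 2) c (place c s)]
  (s \in loops q r).
Proof.
move=> nqr; rewrite inE; apply: (iffP and3P) => [[/eqP-> /eqP-> /forallP h]|[-> -> h]].
  split=> // c [_ hE]; apply: (implyP (h c)); apply/forallP=> x; exact/eqP.
split=> //; apply/forallP=> c; apply/implyP=> /forallP hE.
by apply: h; split=> // x; exact/eqP.
Qed.

Lemma loops_group_set q r : group_set (loops q r).
Proof.
apply/group_setP; split=> [|s t].
  rewrite !inE !perm1 !eqxx /=; apply/forallP=> c; apply/implyP=> _.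
  by rewrite place1.
rewrite !inE !permM => /and3P[/eqP sq /eqP sr /forallP hs].
case/and3P=> /eqP tq /eqP tr /forallP ht; rewrite sq sr tq tr !eqxx /=.
apply/forallP=> c; apply/implyP=> hc; rewrite placeM.
apply: connect_trans (implyP (hs c) hc) _; apply: (implyP (ht _)).
apply/forallP=> x; rewrite -(permKV s x) hole_place (eqP (forallP hc _)).
by rewrite -{2}sq -{2}sr !(inj_eq perm_inj).
Qed.
Canonical loops_group q r := Group (loops_group_set q r).

Lemma loopsC q r : loops q r = loops r q.
Proof.
apply/setP=> s; rewrite !inE andbCA; congr [&& _, _ & _].
apply: eq_forallb => c; congr (_ ==> _).
by apply: eq_forallb => x; rewrite orbC.
Qed.

(** A closed walk from {p, r}: slide the holes to {q, r}, run the given walk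
from there, and slide them back. *)
Lemma loopsJ p q r s : tri p q r -> s \in loops q r -> s ^ tperm p q \in loops p r.
Proof.
move=> T; have [npq nqr npr] := tri_neq T.
case/(loopsP _ nqr) => sq sr sc; apply/(loopsP _ npr).
have tr : tperm p q r = r by rewrite tpermD.
rewrite conjgE tpermV; split; first by rewrite !permM tpermL sq tpermR.
  by rewrite !permM !tr sr tr.
have T' : tri q p r by rewrite tri_swap.
move=> c hc; have [c1 h1] := slide_step T' hc.
rewrite placeM tpermC placeM.
apply: connect_trans c1 _; apply: connect_trans (sc _ h1) _.
have h2 : holes (place (place c (tperm q p)) s) q r.
  by have := holes_place s h1; rewrite sq sr.
by have [] := slide_step T h2; rewrite tpermC.
Qed.

Lemma cyc3_on_slide p q r (S : {set B}) : tri p q r -> p \in S -> q \in S ->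
  cyc3_on (S :\: [set q; r]) (loops q r) -> cyc3_on (S :\: [set p; r]) (loops p r).
Proof.
move=> T pS qS h; have [npq nqr npr] := tri_neq T.
have h' := cyc3_onJ (s := tperm p q) (H := loops_group q r) (K := loops_group p r)
  (fun u => @loopsJ p q r u T) h.
apply: cyc3_onS h'; apply/subsetP=> x.
rewrite !inE => /andP[/norP[xp xr] xS].
apply/imsetP; exists (tperm p q x); last by rewrite tpermK.
rewrite !inE; case: tpermP => [xE|_|_ xq].
- by case/eqP: xp.
- by rewrite negb_or npr npq pS.
by rewrite negb_or xr xS !andbT; apply/eqP.
Qed.

End Moves.

(** * The hexagon around a cell *)

Ltac tperm_eval :=
  repeat match goal with
  | |- context [fun_of_perm (tperm ?x ?y) ?z] => is_var z;
     first [ rewrite (tpermL x y) | rewrite (tpermR x y)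
           | rewrite (@tpermD _ x y z); [ | by distinct | by distinct ] ]
  end.

Section Spin.
Variable T : finType.
Implicit Types r : T.
Local Open Scope group_scope.

(** The six slides that lead a hole from r0 around the hexagon r0 ... r5, the
other hole being at its centre: each one moves the next tile into the hole. *)
Definition spin6 r0 r1 r2 r3 r4 r5 : {perm T} :=
  tperm r1 r0 * tperm r2 r1 * tperm r3 r2 * tperm r4 r3 * tperm r5 r4 * tperm r0 r5.

Lemma spin6E v r0 r1 r2 r3 r4 r5 (s := spin6 r0 r1 r2 r3 r4 r5) :
  uniq [:: v; r0; r1; r2; r3; r4; r5] ->
  [/\ s v = v, s r0 = r0, map s [:: r1; r5; r4; r3; r2] = [:: r5; r4; r3; r2; r1]
    & forall z, z \notin [:: r1; r5; r4; r3; r2] -> s z = z].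
Proof.
distinct_hyps; have s0 : s r0 = r0 by rewrite !permM; tperm_eval.
have sz z : z \notin [:: r1; r5; r4; r3; r2] -> s z = z.
  by case: (eqVneq z r0) => [-> //|n0]; distinct_hyps; rewrite !permM; tperm_eval.
split=> //; first by apply: sz; distinct.
by rewrite /= !permM; tperm_eval.
Qed.

Lemma uniq_heads v r a b (l : seq T) :
  uniq [:: v, r, a, b & l] -> [/\ a != r, b != r & a != b].
Proof.
rewrite /= !inE !negb_or -!andbA => /and5P[_ _ _ _ /and5P[ra rb _ ab _]].
by rewrite !(eq_sym _ r).
Qed.
End Spin.

Section Dir.
Local Open Scope ring_scope.

(** The six directions in cyclic order, indexed modulo 6 so that a rotation of
the hexagon is a shift of the index. *)
Definition dir n : hex :=
  nth (0, 0) [:: (1, 0); (1, 1); (0, 1); (-1, 0); (-1, -1); (0, -1)] (n %% 6).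

Lemma dir_mod n k : dir (n + k) = dir (n %% 6 + k).
Proof. by rewrite /dir modnDml. Qed.

Lemma dir6 n : dir (n + 6) = dir n.
Proof. by rewrite /dir modnDr. Qed.

Lemma dir_adj n (v : hex) : hex_adj v (v + dir n).
Proof.
rewrite /hex_adj addrAC subrr add0r -[n]addn0 dir_mod.
(* only the residue of n matters, which leaves six computations *)
by case: (n %% 6)%N (ltn_pmod n (isT : 0 < 6)%N) => [|[|[|[|[|[|]]]]]].
Qed.

Lemma dir_adjS n (v : hex) : hex_adj (v + dir n) (v + dir n.+1).
Proof.
rewrite /hex_adj opprD addrACA subrr add0r -[n]addn0 -addnS !(dir_mod n).
by case: (n %% 6)%N (ltn_pmod n (isT : 0 < 6)%N) => [|[|[|[|[|[|]]]]]].
Qed.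

Lemma dir_opp n : dir n + dir (n + 3) = 0.
Proof.
rewrite -[X in dir X + _]addn0 !(dir_mod n).
by case: (n %% 6)%N (ltn_pmod n (isT : 0 < 6)%N) => [|[|[|[|[|[|]]]]]].
Qed.

Lemma dir_next n : dir n + dir (n + 2) = dir (n + 1).
Proof.
rewrite -[X in dir X + _]addn0 !(dir_mod n).
by case: (n %% 6)%N (ltn_pmod n (isT : 0 < 6)%N) => [|[|[|[|[|[|]]]]]].
Qed.

Lemma dir_prev n : dir n + dir (n + 4) = dir (n + 5).
Proof.
rewrite -[X in dir X + _]addn0 !(dir_mod n).
by case: (n %% 6)%N (ltn_pmod n (isT : 0 < 6)%N) => [|[|[|[|[|[|]]]]]].
Qed.

Lemma dir_wheel n : uniq [:: 0; dir n; dir (n + 1); dir (n + 2); dir (n + 3);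
  dir (n + 4); dir (n + 5)].
Proof.
rewrite -[X in [:: 0, dir X & _]]addn0 !(dir_mod n).
by case: (n %% 6)%N (ltn_pmod n (isT : 0 < 6)%N) => [|[|[|[|[|[|]]]]]].
Qed.

Lemma dir_two_wheels n :
  uniq [:: dir (n + 1); dir (n + 5); dir (n + 2); dir (n + 3); dir (n + 4);
     dir n + dir (n + 5); dir n + dir (n + 6); dir n + dir (n + 7)].
Proof.
rewrite -[X in dir X + _]addn0 -[X in [:: _, _, _, _, _, _, dir X + _ & _]]addn0
  -[X in [:: _, _, _, _, _, _, _, dir X + _ & _]]addn0 !(dir_mod n).
by case: (n %% 6)%N (ltn_pmod n (isT : 0 < 6)%N) => [|[|[|[|[|[|]]]]]].
Qed.

Lemma hex_adj_dir (v w : hex) : hex_adj v w -> exists2 n, (n < 6)%N & w = v + dir n.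
Proof.
rewrite /hex_adj => h; suff [n ltn E] : exists2 n, (n < 6)%N & w - v = dir n.
  by exists n; rewrite // -E addrC subrK.
move: h; rewrite !inE => /or4P[/eqP->|/eqP->|/eqP->|/or3P[]/eqP->].
- by exists 0%N.
- by exists 3%N.
- by exists 2%N.
- by exists 5%N.
- by exists 1%N.
by exists 4%N.
Qed.

Lemma dir_shift n i : exists2 k, (k < 6)%N & dir n = dir (i + k).
Proof.
exists ((n + (6 - i %% 6)) %% 6)%N; first by rewrite ltn_pmod.
rewrite dir_mod /dir modnDmr; congr nth.
by rewrite addnCA subnKC ?modnDr // ltnW // ltn_pmod.
Qed.
End Dir.

(** * Closed walks around interior cells *)

Section Wheels.
Variable B : board.
Implicit Types (p q r u v w x y z : B) (S T : {set B}).

Definition interior v := [forall n : 'I_6, (val v + dir n)%R \in B].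
(** Meaningful for interior v only; elsewhere [insubd] may return the default
value v. *)
Definition ring v n : B := insubd v (val v + dir n)%R.
Definition flower v : {set B} := [set x | (x == v) || adj v x].

Lemma val_ring v n : interior v -> val (ring v n) = (val v + dir n)%R.
Proof.
move=> /forallP h; rewrite val_insubd ifT // -[n]addn0 (dir_mod n) addn0.
exact: (h (Ordinal (ltn_pmod n (isT : 0 < 6)))).
Qed.

Lemma ring6 v n : ring v (n + 6) = ring v n.
Proof. by rewrite /ring dir6. Qed.

Lemma ring_adj v n : interior v -> adj v (ring v n).
Proof. by move=> iv; rewrite /adj val_ring // dir_adj. Qed.

Lemma ring_adjS v n : interior v -> adj (ring v n) (ring v n.+1).
Proof. by move=> iv; rewrite /adj !val_ring // dir_adjS. Qed.

Lemma ring_tri v n : interior v -> tri (ring v n.+1) (ring v n) v.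
Proof.
by move=> iv; apply/and3P; rewrite ![adj _ v]adjC !ring_adj // adjC ring_adjS.
Qed.

Lemma adj_ring v x i : interior v -> adj v x ->
  exists2 k, k < 6 & x = ring v (i + k).
Proof.
move=> iv /hex_adj_dir[n _ E]; have [k ltk Ek] := dir_shift n i.
by exists k => //; apply: val_inj; rewrite val_ring // -Ek.
Qed.

Lemma uniq_val (v : B) (s : seq B) (e : seq hex) :
  map val s = map (+%R (val v)) e -> uniq s = uniq e.
Proof.
move=> E; rewrite -(map_inj_uniq val_inj) E map_inj_uniq //; exact: addrI.
Qed.

Lemma wheel_uniq v i : interior v ->
  uniq [:: v; ring v i; ring v (i + 1); ring v (i + 2); ring v (i + 3);
     ring v (i + 4); ring v (i + 5)].
Proof.
move=> iv; rewrite (uniq_val (v := v) (e := [:: 0%R; dir i; dir (i + 1);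
   dir (i + 2); dir (i + 3); dir (i + 4); dir (i + 5)])); first exact: dir_wheel.
by rewrite /= !val_ring // addr0.
Qed.

Definition spin v i := spin6 (ring v i) (ring v (i + 1)) (ring v (i + 2))
  (ring v (i + 3)) (ring v (i + 4)) (ring v (i + 5)).

Lemma spin_loop v i : interior v -> spin v i \in loops v (ring v i).
Proof.
move=> iv; have U := wheel_uniq i iv.
have [sv s0 _ _] := spin6E U.
apply/loopsP; first exact/adj_neq/ring_adj.
split=> // c hc; pose t n := tperm (ring v (i + n.+1)) (ring v (i + n)).
(* after n slides the second hole is at ring v (i + n) *)
pose good s n := connect (@puz B 2) c (place c s) /\
  holes (place c s) (ring v (i + n)) v.
have step n s : good s n -> good (s * t n)%g n.+1.
  case=> cs hs; have T : tri (ring v (i + n.+1)) (ring v (i + n)) v.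
    by rewrite addnS; exact: ring_tri.
  have [cs' hs'] := slide_step T hs; rewrite /good placeM.
  by split=> //; exact: connect_trans cs'.
have g0 : good 1%g 0.
  by split; rewrite place1 ?connect0 // addn0; exact: holesC.
have [] := step _ _ (step _ _ (step _ _ (step _ _ (step _ _ (step _ _ g0))))).
by rewrite mul1g /t ring6 addn0.
Qed.

(** Closed walks with a hole at v give all even permutations of S. The position
of the other hole is left open so that the two holes can exchange their roles in
[full_move]; by [full_turn] one position decides for all. *)
Definition full v S := flower v \subset S /\
  forall r, adj v r -> cyc3_on (S :\: [set v; r]) (loops v r).

(** The second hole turns around v inside the hexagon, hence inside S. *)
Lemma full_turn v S i : interior v -> flower v \subset S ->
  cyc3_on (S :\: [set v; ring v i]) (loops v (ring v i)) -> full v S.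
Proof.
move=> iv sfS hi; split=> // r vr; have [k _ ->] := adj_ring i iv vr.
have ringS n : ring v n \in S by apply: (subsetP sfS); rewrite inE ring_adj ?orbT.
elim: k => [|k IH]; first by rewrite addn0.
rewrite addnS loopsC setUC; apply: cyc3_on_slide (ring_tri (i + k) iv) _ _ _ => //.
by rewrite loopsC setUC.
Qed.

Lemma full_move v w S : interior w -> full v S -> adj v w ->
  flower w \subset S -> full w S.
Proof.
move=> iw [_ h] vw sfS; have wv : adj w v by rewrite adjC.
have [k _ E] := adj_ring 0 iw wv.
by apply: (full_turn iw sfS (i := 0 + k)); rewrite -E loopsC setUC; exact: h.
Qed.

(** Both sets contain the hexagon around v, so they share at least five cells
besides the two holes. *)
Lemma fullU v S S' : interior v -> full v S -> full v S' -> full v (S :|: S').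
Proof.
move=> iv [fS hS] [fS' hS'].
split=> [|r vr]; first exact: subset_trans (subsetUl _ _).
have [i _ E] := adj_ring 0 iv vr.
have [n1 n2 n12] := uniq_heads (wheel_uniq (0 + i) iv).
have ringI n : ring v n != r ->
    ring v n \in (S :\: [set v; r]) :&: (S' :\: [set v; r]).
  have := adj_neq (ring_adj n iv); have := ring_adj n iv.
  rewrite !inE eq_sym => an /negPf-> /negPf->.
  by rewrite (subsetP fS) ?(subsetP fS') // inE an orbT.
rewrite setDUl.
apply: (@cyc3_onU _ _ _ _ (ring v (0 + i + 1)) (ring v (0 + i + 2))).
- exact: n12.
- by apply: ringI; rewrite E; exact: n1.
- by apply: ringI; rewrite E; exact: n2.
- exact: hS.
exact: hS'.
Qed.

(** For adjacent interior cells v and w, the hexagon around w seen from v: its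
cells v, [ring_prev] and [ring_next] are the centre of the other hexagon and the
two cells common to both hexagons. *)
Section TwoWheels.
Variables (v : B) (i : nat).
Local Notation w := (ring v i).
Hypotheses (iv : interior v) (iw : interior w).

Let val_ring2 n : val (ring w (i + n)) = (val v + (dir i + dir (i + n)))%R.
Proof. by rewrite !val_ring // addrA. Qed.

Lemma ring_back : ring w (i + 3) = v.
Proof. by apply: val_inj; rewrite val_ring2 dir_opp addr0. Qed.

Lemma ring_prev : ring w (i + 4) = ring v (i + 5).
Proof. by apply: val_inj; rewrite val_ring2 dir_prev val_ring. Qed.

Lemma ring_next : ring w (i + 8) = ring v (i + 1).
Proof.
rewrite (addnA i 2 6) ring6.
by apply: val_inj; rewrite val_ring2 dir_next val_ring.
Qed.

(** In the order of the points x, y, a1, a2, a3, b1, b2, b3 of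
[two_five_cycles]. *)
Definition rim2 := [:: ring v (i + 1); ring v (i + 5); ring v (i + 2); ring v (i + 3);
  ring v (i + 4); ring w (i + 5); ring w (i + 6); ring w (i + 7)].

Lemma rim2_uniq : uniq rim2.
Proof.
rewrite (uniq_val (v := v) (e := [:: dir (i + 1); dir (i + 5); dir (i + 2);
   dir (i + 3); dir (i + 4); dir i + dir (i + 5); dir i + dir (i + 6);
   dir i + dir (i + 7)]%R)); first exact: dir_two_wheels.
by rewrite /= !val_ring2 !val_ring.
Qed.

Lemma mem_rim2 : (flower v :|: flower w) :\: [set v; w] \subset [set z in rim2].
Proof.
have subl (T : eqType) (z x y a1 a2 a3 b1 b2 b3 : T) :
    z \in [:: x; y; a1; a2; a3] -> z \in [:: x; y; a1; a2; a3; b1; b2; b3].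
  by rewrite (mem_cat z [:: x; y; a1; a2; a3] [:: b1; b2; b3]) => ->.
have subr (T : eqType) (z x y a1 a2 a3 b1 b2 b3 : T) :
    z \in [:: y; b1; b2; b3; x] -> z \in [:: x; y; a1; a2; a3; b1; b2; b3].
  by rewrite !inE => /or4P[|||/orP[]] ->; rewrite ?orbT.
have Ring k : 0 < k < 6 -> ring v (i + k) \in rim2.
  move=> lek; have : k \in [:: 1; 5; 2; 3; 4].
    by case: k lek => [|[|[|[|[|[|]]]]]].
  by move/(map_f (fun k => ring v (i + k))); exact: subl.
have Ring' k : 0 < k < 6 -> ring w (i + 3 + k) \in rim2.
  move=> lek; have : k \in [:: 1; 2; 3; 4; 5].
    by case: k lek => [|[|[|[|[|[|]]]]]].
  move/(map_f (fun k => ring w (i + 3 + k))); rewrite /= -!addnA.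
  by rewrite -[3 + 1]/4 -[3 + 5]/8 ring_prev ring_next; exact: subr.
apply/subsetP=> z; rewrite in_setD in_set2 negb_or => /andP[/andP[zv zw]].
rewrite in_setU ![z \in flower _]inE (negPf zv) (negPf zw) /= in_set => /orP[vz|wz].
  have [k ltk Ek] := adj_ring i iv vz; rewrite Ek; apply: Ring.
  by rewrite ltk andbT lt0n; apply: contraNneq zw => k0; rewrite Ek k0 addn0.
have [k ltk Ek] := adj_ring (i + 3) iw wz; rewrite Ek; apply: Ring'.
rewrite ltk andbT lt0n; apply: contraNneq zv => k0.
by rewrite Ek k0 addn0 ring_back.
Qed.

(** The holes at v and w can circle around v or around w; these are the two
five-cycles of [two_five_cycles]. *)
Lemma full_two_wheels : full v (flower v :|: flower w).
Proof.
apply: (full_turn iv (i := i)); rewrite ?subsetUl //.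
have Uv := wheel_uniq i iv; have Uw := wheel_uniq (i + 3) iw.
have sH := spin_loop i iv; have tH := spin_loop (i + 3) iw.
move: Uw tH; rewrite /spin -!addnA.
rewrite -[3 + 1]/4 -[3 + 2]/5 -[3 + 3]/6 -[3 + 4]/7 -[3 + 5]/8.
rewrite ring_back ring_prev ring_next loopsC => Uw tH.
have [_ _ sv fv] := spin6E Uv.
have [_ _ sw fw] := spin6E Uw.
apply: cyc3_onS mem_rim2 _.
exact: (two_five_cycles (H := loops_group v w) rim2_uniq sH tH sv sw fv fw).
Qed.
End TwoWheels.

Lemma full_two_flowers v w : interior v -> interior w -> adj v w ->
  full v (flower v :|: flower w).
Proof.
move=> iv iw vw; have [i _ E] := adj_ring 0 iv vw.
by rewrite E in iw *; exact: full_two_wheels.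
Qed.
End Wheels.

(** * Walks of the holes through the interior *)

Section Walks.
Variable B : board.
Implicit Types (p q r u v w x y z : B) (S T : {set B}) (c d : config B 2).

Definition covered : {set B} :=
  [set x | [exists u : B, interior u && (x \in flower u)]].

Definition carries q r q' r' :=
  forall c, holes c q r -> exists2 d, connect (@puz B 2) c d & holes d q' r'.

Lemma carries_trans q r q' r' q'' r'' :
  carries q r q' r' -> carries q' r' q'' r'' -> carries q r q'' r''.
Proof.
move=> h h' c /h[d cd /h'[e de he]]; exists e => //; exact: connect_trans de.
Qed.

Lemma carriesC q r : carries q r r q.
Proof. by move=> c h; exists c; [exact: connect0 | exact: holesC]. Qed.

Lemma carries_refl q r : carries q r q r.
Proof. by move=> c h; exists c; first exact: connect0. Qed.

Lemma carries_tri p q r : tri p q r -> carries q r p r.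
Proof.
by move=> T c h; have [? ?] := slide_step T h; exists (place c (tperm p q)).
Qed.

Lemma carries_wheel v r r' : interior v -> adj v r -> adj v r' ->
  carries v r v r'.
Proof.
move=> iv vr vr'; have [i _ ->] := adj_ring 0 iv vr.
have [k _ ->] := adj_ring (0 + i) iv vr'.
elim: k => [|k IH]; first by rewrite addn0; exact: carries_refl.
apply: carries_trans IH _; apply: carries_trans (@carriesC _ _) _.
apply: carries_trans (@carriesC _ _); rewrite addnS.
exact/carries_tri/ring_tri.
Qed.

Variables (v0 v1 : B) (rank : B -> nat).
Hypotheses (iv0 : interior v0) (iv1 : interior v1) (v01 : adj v0 v1).
(* the interior cells are connected: descending in rank leads to v0 *)
Hypothesis descend : forall u, interior u -> u != v0 ->
  exists u', [/\ interior u', adj u u' & rank u' < rank u].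

Lemma carries_base u r : interior u -> adj u r -> carries u r v0 v1.
Proof.
have [n] := ubnP (rank u); elim: n u r => // n IHn u r ltn iu ur.
have [E|nu] := eqVneq u v0; first by rewrite E in iu ur *; exact: carries_wheel.
have [u' [iu' uu' lt']] := descend iu nu.
apply: carries_trans (carries_wheel iu ur uu') _.
apply: carries_trans (@carriesC _ _) _.
by apply: IHn; rewrite // 1?adjC //; apply: leq_trans lt' _.
Qed.

(** On the way to v0, the set T is enlarged by the hexagons around the cells of
the path, so that each next step of the holes stays inside the set. *)
Lemma full_base u T : interior u -> full u T ->
  exists2 S : {set B}, T \subset S & full v0 S.
Proof.
have [n] := ubnP (rank u); elim: n u T => // n IHn u T ltn iu fu.
have [E|nu] := eqVneq u v0; first by rewrite -E; exists T.
have [u' [iu' uu' lt']] := descend iu nu.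
have f1 := fullU iu fu (full_two_flowers iu iu' uu').
have f2 : full u' (T :|: (flower u :|: flower u')).
  by apply: full_move f1 _ _; rewrite // setUA subsetUr.
have [] // := IHn u' _ _ iu' f2; first exact: leq_trans lt' _.
by move=> S sS; exists S => //; apply: subset_trans sS; exact: subsetUl.
Qed.

Lemma full_at u : interior u ->
  exists2 S : {set B}, flower u \subset S & full v0 S.
Proof.
move=> iu; have [E|nu] := eqVneq u v0.
  exists (flower v0 :|: flower v1); first by rewrite E subsetUl.
  exact: full_two_flowers.
have [u' [iu' uu' _]] := descend iu nu.
have [S sS fS] := full_base iu (full_two_flowers iu iu' uu').
by exists S => //; apply: subset_trans sS; exact: subsetUl.
Qed.

(** A three-cycle involves three cells only, so it suffices to join the sets
that [full_at] gives for them. *)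
Lemma cyc3_on_covered : cyc3_on (covered :\: [set v0; v1]) (loops v0 v1).
Proof.
move=> a b c; rewrite inE => /andP[na]; rewrite inE => /existsP[u /andP[iu ua]].
rewrite inE => /andP[nb]; rewrite inE => /existsP[v /andP[iv vb]].
rewrite inE => /andP[nc]; rewrite inE => /existsP[w /andP[iw wc]].
have [S1 /subsetP s1 f1] := full_at iu; have [S2 /subsetP s2 f2] := full_at iv.
have [S3 /subsetP s3 f3] := full_at iw.
have [_ h] := fullU iv0 (fullU iv0 f1 f2) f3.
by apply: (h _ v01); rewrite in_setD ?na ?nb ?nc /= !in_setU
  ?(s1 _ ua) ?(s2 _ vb) ?(s3 _ wc) ?orbT.
Qed.

(* an acute corner triangle has no interior cell itself; its inner side borders a
   triangle that has one *)
Hypothesis near_interior : forall p q r, tri p q r -> exists x y u,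
  [/\ x \in [:: p; q; r], y \in [:: p; q; r], x != y & interior u /\ tri u x y].

Lemma carries_within p q r x y : tri p q r -> x \in [:: p; q; r] ->
  y \in [:: p; q; r] -> x != y -> carries q r x y.
Proof.
move=> T.
have cpr : carries q r p r by exact: carries_tri.
have cpq : carries q r p q.
  apply: carries_trans (@carriesC _ _) _.
  by apply: carries_tri; rewrite -tri_rot tri_swap.
rewrite !inE => /or3P[]/eqP-> /or3P[]/eqP->; rewrite ?eqxx // => _.
- exact: carries_trans cpq (@carriesC _ _).
- exact: carries_refl.
- exact: carries_trans cpr (@carriesC _ _).
exact: carriesC.
Qed.

Lemma non_isolated_base c : non_isolated c ->
  exists2 d, connect (@puz B 2) c d & holes d v0 v1.
Proof.
case/non_isolatedP=> p [q [r [T h]]].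
have [x [y [u [xT yT nxy [iu uxy]]]]] := near_interior T.
have [d cd hd] := carries_within T xT yT nxy h.
have [e de he] := carries_tri uxy hd.
have uy : adj u y by case/and3P: uxy.
have [f ef hf] := carries_base iu uy he.
by exists f => //; apply: connect_trans cd (connect_trans de ef).
Qed.
End Walks.

(** * Invariants of slides *)

Section Invariant.
Variable B : board.
Implicit Types (p q r k x y z : B) (c d : config B 2) (s t : {perm B}).
Local Open Scope group_scope.

Definition corner k := #|[set x | adj k x]| <= 2.

Lemma corner_third k x y z : corner k -> adj k x -> adj k y -> adj k z ->
  z != x -> z != y -> x = y.
Proof.
rewrite /corner => kc kx ky kz zx zy; apply/eqP; apply: contraLR kc => xy.
rewrite -ltnNge; have <- : #|[set x; y; z]| = 3.
  by rewrite -setUA cardsU1 cards2 !inE !negb_or xy !(eq_sym _ z) zx zy.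
by apply/subset_leq_card/subsetP => w; rewrite !inE => /orP[/orP[]|] /eqP->.
Qed.

Lemma holes_uniq c q r q' r' : holes c q r -> holes c q' r' ->
  (q' = q /\ r' = r) \/ (q' = r /\ r' = q).
Proof.
case=> nqr E [nqr' E'].
have: hole c q' by rewrite E' eqxx.
have: hole c r' by rewrite E' eqxx orbT.
move: nqr'; rewrite !E => n /orP[]/eqP er /orP[]/eqP eq'; move: n;
  by rewrite er eq' ?eqxx //; auto.
Qed.

(** Here s takes the initial configuration to the present one, and h1, h2 are
the initial holes. The tile of the corner k is in place, or else it waits next
to k while k is a hole. *)
Definition corner_kept h1 h2 s k :=
  (s k == k) || (k \in [set s h1; s h2]) && adj k (s k).

(** If the tile of k is displaced, then k and its only two neighbours form the
triangle of the holes, so the next slide moves this very tile. *)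
Lemma corner_kept_slide h1 h2 s k p q r (s' := s * tperm p q * tperm p r) :
  corner k -> k != h1 -> k != h2 -> tri p q r ->
  [set s h1; s h2] = [set q; r] -> [set s' h1; s' h2] = [set p; r] ->
  corner_kept h1 h2 s k -> corner_kept h1 h2 s' k.
Proof.
move=> kc k1 k2 T E E'; have [npq nqr npr] := tri_neq T.
have [pq qr pr] := and3P T; have nrq : r != q by rewrite eq_sym.
have : s k \notin [set s h1; s h2] by rewrite !inE !(inj_eq perm_inj) negb_or k1 k2.
rewrite /corner_kept E E' in_set2 negb_or => /andP[skq skr].
rewrite /s' !permM => /orP[/eqP sk|/andP[]].
  rewrite sk in skq skr *; case: (eqVneq k p) => [->|nkp].
    by rewrite tpermL [tperm p r q]tpermD // set21 pq orbT.
  by rewrite [tperm p q k]tpermD 1?eq_sym // tpermD 1?eq_sym // eqxx.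
rewrite in_set2 => /orP[] /eqP Ek ksk.
  have <- : p = s k.
    by apply: (corner_third kc _ ksk (z := r));
      [rewrite Ek adjC | rewrite Ek | rewrite eq_sym | rewrite eq_sym].
  by rewrite tpermL tpermD // Ek eqxx.
have <- : p = s k.
  by apply: (corner_third kc _ ksk (z := q));
    [rewrite Ek adjC | rewrite Ek adjC | rewrite eq_sym | rewrite eq_sym].
by rewrite tpermL [tperm p r q]tpermD // in_set2 Ek eqxx orbT adjC qr orbT.
Qed.

(** The holes are tracked as a source s h1 and a target s h2. Exchanging the
tile at p with the hole q would leave the new holes p and r in the wrong order;
exchanging them as well, which displaces no tile, restores the order and makes
the step even. *)
Lemma connect_invariant h1 h2 c d :
  connect (@puz B 2) c d -> holes c h1 h2 -> pos h1 h2 ->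
  exists s, [/\ d = place c s, ~~ odd_perm s, pos (s h1) (s h2) &
    forall k, corner k -> k != h1 -> k != h2 -> corner_kept h1 h2 s k].
Proof.
move=> /connectP[l + ->] hc p12; elim/last_ind: l => [_|l e IH].
  exists 1; rewrite place1 odd_perm1 !perm1; split=> // k _ _ _.
  by rewrite /corner_kept perm1 eqxx.
rewrite rcons_path last_rcons => /andP[/IH[s [Es ev ps st]]].
rewrite puzE Es => /slideP[p [q [r [T H ->]]]].
have [npq nqr npr] := tri_neq T.
pose s' := s * tperm p q * tperm p r.
have hs := holes_place s hc.
have qr : adj q r by case/and3P: T.
have [E [E' p']] : [set s h1; s h2] = [set q; r] /\
    [set s' h1; s' h2] = [set p; r] /\ pos (s' h1) (s' h2).
  case: (holes_uniq H hs) ps => [[e1 e2]|[e1 e2]].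
    rewrite /s' !permM e1 e2 tpermR tpermL [tperm p q r]tpermD // tpermR => pqr.
    have T' : tri q r p by rewrite -tri_rot.
    by have [rp _] := pos_triangle T' pqr; split=> //; split; [exact: setUC|].
  rewrite /s' !permM e1 e2 tpermR tpermL [tperm p q r]tpermD // tpermR => prq.
  have T' : tri r q p by rewrite tri_swap -tri_rot.
  by have [_ pr] := pos_triangle T' prq; split; [exact: setUC|].
exists s'; split=> //; last first.
- by move=> k kc k1 k2; apply: corner_kept_slide (st _ _ _ _).
- by rewrite /s' !odd_permM !odd_tperm npq npr (negPf ev).
rewrite /s' !placeM -[LHS]place1; apply: eq_place => x.
have [_ ->] := holes_place (tperm p q) H; rewrite tpermR tpermD // negb_or.
by case/andP=> xp xr; rewrite perm1 tpermD // eq_sym.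
Qed.

(** With [place_injective]: the permutations that fix q and r act simply
transitively on the configurations with holes q and r. *)
Lemma exists_place c d q r : holes c q r -> holes d q r ->
  exists s, [/\ s q = q, s r = r & d = place c s].
Proof.
move=> [nqr hc] [_ hd].
pose f x := if [pick a | val c a == x] is Some a then val d a else x.
have fc a : f (val c a) = val d a.
  by rewrite /f; case: pickP => [b /eqP/cfg_inj -> //|/(_ a)]; rewrite eqxx.
have fh x : hole c x -> f x = x.
  move=> hx; rewrite /f; case: pickP => // a /eqP E.
  by case/negP: hx; rewrite -E codom_f.
have f_inj : injective f.
  move=> x y; case: (boolP (hole c x)) => [hx|/negbNE/codomP[a ->]].
    rewrite fh //; case: (boolP (hole c y)) => [hy|/negbNE/codomP[b ->]].
      by rewrite fh.
    by move: hx; rewrite fc hc -hd => /negP h E; case: h; rewrite E codom_f.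
  rewrite fc; case: (boolP (hole c y)) => [hy|/negbNE/codomP[b ->]].
    by move: (hy); rewrite fh // hc -hd => /negP h E; case: h; rewrite -E codom_f.
  by rewrite fc => /cfg_inj ->.
exists (perm f_inj); split; rewrite ?permE ?fh // ?hc ?eqxx ?orbT //.
by apply: cfgP => a; rewrite placeE permE fc.
Qed.

Lemma place_injective c q r s t :
  holes c q r -> s q = q -> s r = r -> t q = q -> t r = r ->
  place c s = place c t -> s = t.
Proof.
move=> [_ hc] sq sr tq tr E; apply/permP=> x; case: (boolP (hole c x)).
  by rewrite hc => /orP[] /eqP ->; rewrite ?sq ?sr.
by rewrite negbK => /codomP[a ->]; rewrite -!placeE E.
Qed.

Lemma exists_holes q r : q != r -> exists c, holes c q r.
Proof.
move=> nqr; have cA : #|~: [set q; r]| = #|`B| - 2.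
  by rewrite cardsCs setCK cards2 nqr cardfE.
pose f := [ffun a : tile B 2 => enum_val (cast_ord (esym cA) a)].
have f_inj : injectiveb f.
  by apply/injectiveP => a b; rewrite !ffunE => /enum_val_inj/cast_ord_inj.
exists (exist _ f f_inj); apply: holesP => //; first exact: board2 nqr.
  apply/negP => /codomP[a]; rewrite ffunE => E.
  by have := enum_valP (cast_ord (esym cA) a); rewrite -E !inE eqxx.
apply/negP => /codomP[a]; rewrite ffunE => E.
by have := enum_valP (cast_ord (esym cA) a); rewrite -E !inE eqxx orbT.
Qed.

End Invariant.

(** * The number of components as an index *)

(** Multiplication by a transposition exchanges even and odd permutations. *)
Lemma card_even_perm_on (T : finType) (A : {set T}) : 1 < #|A| ->
  #|[set s : {perm T} | perm_on A s && ~~ odd_perm s]| * 2 = (#|A|)`!.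
Proof.
case/card_gt1P=> a [b [aA bA nab]].
have onab : perm_on A (tperm a b).
  apply/subsetP=> x; rewrite inE; apply: contraR => xA.
  by rewrite tpermD //; apply: contraNneq xA => <-.
rewrite -card_perm muln2 -addnn -[RHS](cardID [pred s : {perm T} | ~~ odd_perm s]).
congr (_ + _); first by rewrite cardsE; apply: eq_card => s; rewrite !inE.
rewrite -(card_imset _ (mulIg (tperm a b))); apply: eq_card => s.
apply/imsetP/idP => [[t]|].
  rewrite !inE => /andP[tA ev] ->.
  by rewrite odd_permM odd_tperm nab (negPf ev); apply: perm_onM.
rewrite !inE negbK => /andP[od sA]; exists (s * tperm a b)%g.
  by rewrite inE perm_onM // odd_permM odd_tperm nab od.
by rewrite -mulgA tperm2 mulg1.
Qed.

(** If g determines f on A then f has at most as many values as g; used both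
ways, to compare two functions with the same fibres. *)
Lemma leq_card_imset (T U V : finType) (f : T -> U) (g : T -> V) (A : {set T}) :
  {in A &, forall x y, g x = g y -> f x = f y} -> #|f @: A| <= #|g @: A|.
Proof.
move=> gf; have [->|[a0 a0A]] := set_0Vmem A; first by rewrite !imset0 !cards0.
pose h v := f (odflt a0 [pick x in A | g x == v]).
rewrite (leq_trans _ (leq_imset_card h _)) //; apply/subset_leq_card/subsetP.
move=> _ /imsetP[x xA ->]; apply/imsetP; exists (g x); first exact: imset_f.
rewrite /h; case: pickP => [y /andP[yA /eqP gy]|/(_ x)]; last by rewrite xA eqxx.
by apply: gf.
Qed.

Section Count.
Variables (B : board) (v0 v1 : B) (rank : B -> nat).
Implicit Types (c d : config B 2) (s t : {perm B}).
Hypotheses (iv0 : interior v0) (iv1 : interior v1) (v01 : adj v0 v1).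
Hypothesis descend : forall u, interior u -> u != v0 ->
  exists u', [/\ interior u', adj u u' & rank u' < rank u].
Hypothesis near_interior : forall p q r : B, tri p q r -> exists x y u,
  [/\ x \in [:: p; q; r], y \in [:: p; q; r], x != y & interior u /\ tri u x y].
Hypothesis corners : forall k : B, k \notin covered B -> corner k.
Hypothesis room : 4 <= #|covered B|.

Let nv : v0 != v1. Proof. exact: adj_neq. Qed.
Let v0in : v0 \in covered B.
Proof. by rewrite inE; apply/existsP; exists v0; rewrite iv0 inE eqxx. Qed.
Let v1in : v1 \in covered B.
Proof. by rewrite inE; apply/existsP; exists v1; rewrite iv1 inE eqxx. Qed.

(** The end of a closed walk has the holes in the same order as its start, and
the corners are not holes; so the permutation of [connect_invariant] fixes the
holes and the corners. *)
Lemma loops_connect c s : holes c v0 v1 -> s v0 = v0 -> s v1 = v1 ->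
  connect (@puz B 2) c (place c s) ->
  perm_on (covered B :\: [set v0; v1]) s && ~~ odd_perm s.
Proof.
wlog p01 : / exists h1 h2, [/\ pos h1 h2, holes c h1 h2 & [set h1; h2] = [set v0; v1]].
  move=> W hc; apply: W (hc); move: v01; rewrite adjE => /orP[] p01.
    by exists v0, v1.
  by exists v1, v0; split=> //; [exact: holesC | exact: setUC].
case: p01 => h1 [h2 [p12 h12 E]] hc s0 s1 /connect_invariant /(_ h12 p12).
case=> t [st evt pt stay].
have h12' : holes (place c s) h1 h2.
  have sE x : x \in [set v0; v1] -> s x = x by rewrite in_set2 => /orP[]/eqP->.
  by have := holes_place s h12; rewrite !sE // -E ?set21 ?set22.
have [th1 th2] : t h1 = h1 /\ t h2 = h2.
  have := holes_place t h12; rewrite -st => /(holes_uniq h12')[//|[e1 e2]].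
  by move: pt; rewrite e1 e2 => /hex_pos_asym; rewrite /pos in p12; rewrite p12.
have eqst : s = t.
  have sE x : x \in [set v0; v1] -> s x = x by rewrite in_set2 => /orP[]/eqP->.
  by apply: (place_injective h12 _ _ th1 th2 st); rewrite sE // -E ?set21 ?set22.
rewrite eqst evt andbT; apply/subsetP=> x; rewrite inE; apply: contraR.
rewrite in_setD negb_and negbK -E in_set2 => xN.
have [->|n1] := eqVneq x h1; first by rewrite th1.
have [->|n2] := eqVneq x h2; first by rewrite th2.
have kx : corner x by apply: corners; rewrite (negPf n1) (negPf n2) in xN.
have := stay x kx n1 n2; rewrite /corner_kept th1 th2 in_set2 (negPf n1) (negPf n2).
by rewrite /= orbF.
Qed.

Lemma loopsE : loops v0 v1 =
  [set s : {perm B} | perm_on (covered B :\: [set v0; v1]) s && ~~ odd_perm s].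
Proof.
apply/setP=> s; apply/idP/idP => [|].
  case/(loopsP _ nv) => s0 s1 h; have [c hc] := exists_holes nv.
  by rewrite inE; apply: (loops_connect hc) => //; exact: h.
rewrite inE => /andP[on ev]; have H := cyc3_on_covered iv0 iv1 v01 descend.
exact: (cyc3_on_even (H := loops_group v0 v1) H).
Qed.

Lemma connect_loops c s : holes c v0 v1 -> s v0 = v0 -> s v1 = v1 ->
  connect (@puz B 2) c (place c s) = (s \in loops v0 v1).
Proof.
move=> hc s0 s1; apply/idP/idP; last by case/(loopsP _ nv) => _ _; exact.
by move=> h; rewrite loopsE inE; exact: loops_connect hc _ _ h.
Qed.

Definition based := Sym (~: [set v0; v1]).

Lemma basedP s : reflect (s v0 = v0 /\ s v1 = v1) (s \in based).
Proof.
rewrite inE; apply: (iffP idP) => [on|[s0 s1]].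
  by split; apply: (out_perm on); rewrite !inE eqxx ?orbT.
apply/subsetP=> x; rewrite inE; apply: contraR.
by rewrite inE negbK in_set2 => /orP[]/eqP->; rewrite ?s0 ?s1.
Qed.

Lemma loops_sub : loops v0 v1 \subset based.
Proof. by apply/subsetP=> s /(loopsP _ nv)[s0 s1 _]; apply/basedP. Qed.

Lemma eq_component c d : (component c == component d) = connect (@puz B 2) c d.
Proof.
apply/eqP/idP => [/setP/(_ d)|cd]; first by rewrite !inE connect0.
apply/setP=> e; rewrite !inE.
exact: (same_connect (@connect_puzC B)).
Qed.

(** Every component has a member with the holes at v0 and v1, and any two such
configurations differ by a permutation that fixes both cells. *)
Lemma componentsE c : holes c v0 v1 ->
  non_isolated_components B 2 = (fun s => component (place c s)) @: based.
Proof.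
move=> hc; apply/setP=> X; apply/imsetP/imsetP => [[d nd ->]|[s /basedP[s0 s1] ->]].
  have [e de he] := non_isolated_base v01 descend near_interior nd.
  have [s [s0 s1 E]] := exists_place hc he.
  exists s; first exact/basedP.
  by apply/eqP; rewrite -E eq_component.
exists (place c s) => //; apply/non_isolatedP.
have hs : holes (place c s) v0 v1 by have := holes_place s hc; rewrite s0 s1.
have [i _ E] := adj_ring 0 iv0 v01; rewrite E in hs.
exists (ring v0 (0 + i).+1), (ring v0 (0 + i)), v0.
by split; [exact: ring_tri | exact: holesC].
Qed.

(** Components correspond to the left cosets of the group of closed walks. *)
Lemma card_components :
  #|non_isolated_components B 2| = 2 * (#|`B| - 2) ^_ (#|`B| - #|covered B|).
Proof.
have [c hc] := exists_holes nv; rewrite (componentsE hc).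
have hs s : s \in based -> holes (place c s) v0 v1.
  by case/basedP=> s0 s1; have := holes_place s hc; rewrite s0 s1.
have E : #|(fun s => component (place c s)) @: based|
       = #|lcosets (loops v0 v1) based|.
  have same s t : s \in based -> t \in based ->
    (component (place c s) == component (place c t)) =
    ((s *: loops v0 v1)%g == (t *: loops v0 v1)%g).
    move=> sb tb; rewrite eq_component.
    rewrite -(mulKVg s t); set u := (s^-1 * t)%g.
    have /basedP[u0 u1] : u \in based by rewrite groupM ?groupV.
    rewrite placeM (connect_loops (hs s sb)) //.
    rewrite (sameP eqP (lcoset_eqP (G := loops_group v0 v1))).
    by rewrite mem_lcoset invMg mulgKV groupV.
  apply/eqP; rewrite eqn_leq; apply/andP.
  split; apply: leq_card_imset => s t sb tb st; apply/eqP.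
    by rewrite same // -!lcosetE; apply/eqP.
  by rewrite !lcosetE -same // st.
have cA : #|covered B :\: [set v0; v1]| = #|covered B| - 2.
  rewrite cardsD (setIidPr _) ?cards2 ?nv //.
  by apply/subsetP=> x; rewrite in_set2 => /orP[]/eqP->.
have cl : #|loops v0 v1| * 2 = (#|covered B| - 2)`!.
  by rewrite loopsE card_even_perm_on cA // ltn_subRL.
have cb : #|based| = (#|`B| - 2)`!.
  by rewrite card_Sym cardsCs setCK cards2 nv cardfE.
have le : #|covered B| <= #|`B| by rewrite cardfE; exact: max_card.
have L : #|loops v0 v1| * #|lcosets (loops v0 v1) based| = (#|`B| - 2)`!.
  rewrite -cb -(Lagrange (G := Sym_group _) (H := loops_group v0 v1) loops_sub).
  by rewrite card_lcosets.
have l0 : 0 < #|loops v0 v1| by apply/card_gt0P; exists 1%g; exact: group1.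
rewrite E; apply/eqP; rewrite -(eqn_pmul2l l0) L mulnA cl.
rewrite -(ffact_fact (m := #|`B| - #|covered B|)); last first.
  by rewrite leq_sub2l // ltnW // ltnW.
by rewrite mulnC; apply/eqP; congr (_`! * _); lia.
Qed.
End Count.

(** * Boards in coordinates *)

Section BoardCounts.
Local Open Scope ring_scope.

Lemma hex_adjxy (a b c d : int) : hex_adj (a, b) (c, d) =
  [|| (c == a + 1) && (d == b), (c == a - 1) && (d == b),
      (c == a) && (d == b + 1), (c == a) && (d == b - 1),
      (c == a + 1) && (d == b + 1) | (c == a - 1) && (d == b - 1)].
Proof.
rewrite /hex_adj (_ : _ - _ = (c - a, d - b)) // !inE !xpair_eqE; lia.
Qed.

Lemma hex_posxy (a b c d : int) : hex_pos (a, b) (c, d) =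
  [|| (c == a + 1) && (d == b), (c == a) && (d == b + 1)
    | (c == a - 1) && (d == b - 1)].
Proof.
rewrite /hex_pos (_ : _ - _ = (c - a, d - b)) // !inE !xpair_eqE; lia.
Qed.

Definition cells2 (t : nat -> seq nat) (m : nat) : seq hex :=
  [seq (i%:Z, j%:Z) | i <- iota 0 m, j <- t i].

Lemma card_cells2 t m (Bd : board) : (forall i, uniq (t i)) ->
  (forall p, (p \in Bd) = (p \in cells2 t m)) ->
  #|` Bd| = sumn [seq size (t i) | i <- iota 0 m].
Proof.
move=> ut E; rewrite -(size_allpairs_dep (fun i j => (i%:Z, j%:Z) : hex)) -/(cells2 t m).
have U : uniq (cells2 t m).
  apply: allpairs_uniq_dep => [|i _|]; [exact: iota_uniq | exact: ut |].
  by move=> [i j] [i' j'] _ _ /= [-> ->].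
by apply: perm_size; apply: uniq_perm; rewrite ?fset_uniq.
Qed.

Lemma mem_parallelogram m1 m2 p : (p \in parallelogram m1 m2) =
  (0 <= p.1 < m1%:Z) && (0 <= p.2 < m2%:Z).
Proof.
apply/imfset2P/idP => [[i] /=|].
  rewrite mem_iota => im [j] /=; rewrite mem_iota => jm -> /=; lia.
case: p => x y /= h; exists `|x|%N; first by rewrite /= mem_iota; lia.
exists `|y|%N; first by rewrite /= mem_iota; lia.
by congr (_, _); lia.
Qed.

Lemma mem_triangle m p : (p \in triangle m) = (0 <= p.2 <= p.1) && (p.1 < m%:Z).
Proof.
apply/imfset2P/idP => [[i] /=|].
  rewrite mem_iota => im [j].
  rewrite -[_ \in _]/(j \in iota 0 i.+1) mem_iota => jm -> /=; lia.
case: p => x y /= h; exists `|x|%N; first by rewrite /= mem_iota; lia.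
exists `|y|%N.
  rewrite -[_ \in _]/(`|y|%N \in iota 0 `|x|%N.+1) mem_iota; lia.
by congr (_, _); lia.
Qed.

Lemma card_parallelogram m1 m2 : #|` parallelogram m1 m2| = (m1 * m2)%N.
Proof.
rewrite (@card_cells2 (fun=> iota 0 m2) m1) => [|i|[x y]]; last 2 first.
- exact: iota_uniq.
- apply/imfset2P/allpairsPdep => [[i /= im [j /= jm ->]]|[i [j [im jm ->]]]].
    by exists i, j.
  by exists i => //; exists j.
by rewrite size_iota; elim: m1 0%N => //= n IHn k; rewrite IHn mulSn.
Qed.

Lemma card_triangle m : #|` triangle m| = ((m * (m + 1)) %/ 2)%N.
Proof.
rewrite (@card_cells2 (fun i => iota 0 i.+1) m) => [|i|[x y]]; last 2 first.
- exact: iota_uniq.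
- apply/imfset2P/allpairsPdep => [[i /= im [j /= jm ->]]|[i [j [im jm ->]]]].
    by exists i, j.
  by exists i => //; exists j.
elim: m => [|m IHm] //.
rewrite -{1}addn1 iotaD map_cat sumn_cat IHm /= add0n size_iota addn0.
rewrite addnC -(divnMDl m.+1) //; congr (_ %/ 2)%N; lia.
Qed.
End BoardCounts.

Section BoardGeometry.
Variable B : board.
Local Open Scope ring_scope.
Variable core : hex -> bool.
Hypothesis core_sub : forall p, core p -> p \in B.
Hypothesis interiorE : forall v : B, interior v = core (val v).

Lemma core_cell p : core p -> exists2 v : B, val v = p & interior v.
Proof.
by move=> cp; exists [` core_sub cp]%fset; rewrite ?interiorE.
Qed.

Lemma coveredE (k : B) :
  (k \in covered B) = core (val k) || has (fun n => core (val k + dir n)) (iota 0 6).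
Proof.
rewrite inE; apply/existsP/orP => [[u /andP[iu]]|].
  rewrite inE => /orP[/eqP->|uk]; first by left; rewrite -interiorE.
  right; apply/hasP.
  have /hex_adj_dir[n ltn E] : hex_adj (val k) (val u) by rewrite hex_adjC.
  by exists n; rewrite ?mem_iota // -E -interiorE.
case=> [ck|/hasP[n _ /core_cell[u E iu]]].
  by exists k; rewrite interiorE ck inE eqxx.
by exists u; rewrite iu inE adjC /adj E dir_adj orbT.
Qed.

Lemma card_val (A : {set B}) (s : seq hex) : uniq s -> {subset s <= B} ->
  (forall x, (x \in A) = (val x \in s)) -> #|A| = size s.
Proof.
move=> us sB AE; rewrite cardE -(size_map val); apply: perm_size.
apply: uniq_perm; rewrite // ?map_inj_uniq ?enum_uniq //; first exact: val_inj.
move=> p; apply/mapP/idP => [[x]|ps]; first by rewrite mem_enum AE => xs ->.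
by exists [` sB p ps]%fset; rewrite // mem_enum AE.
Qed.

Lemma corner_val (k : B) p q :
  (forall r, r \in B -> hex_adj (val k) r -> r \in [:: p; q]) -> corner k.
Proof.
move=> h; rewrite /corner cardE -(size_map val).
apply: (@uniq_leq_size _ _ [:: p; q]).
  by rewrite map_inj_uniq ?enum_uniq //; exact: val_inj.
by move=> _ /mapP[x xk ->]; apply: h; [exact: valP | move: xk; rewrite mem_enum inE].
Qed.

(* p + q - r is the mirror image of r in the side between p and q *)
Hypothesis core_near : forall p q r : hex, p \in B -> q \in B -> r \in B ->
  hex_pos p q -> hex_pos q r -> hex_pos r p ->
  [|| core p, core q, core r, core (p + q - r), core (q + r - p) | core (r + p - q)].

Lemma hex_adj_mirror p q r : hex_adj q r -> hex_adj (p + q - r) p.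
Proof. by rewrite /hex_adj => h; rewrite -addrA opprD addrA subrr add0r opprB. Qed.

Lemma mem3_swap (T : eqType) (p q r z : T) :
  (z \in [:: p; q; r]) = (z \in [:: q; p; r]).
Proof. by rewrite !inE orbCA. Qed.

Lemma near_core (p q r : B) : tri p q r -> exists x y u : B,
  [/\ x \in [:: p; q; r], y \in [:: p; q; r], x != y & interior u /\ tri u x y].
Proof.
wlog p01 : p q r / pos p q => [W T|T].
  have [npq _ _] := tri_neq T.
  have /orP[|qp] : pos p q || pos q p by rewrite -adjE; case/and3P: T.
    by move/W => /(_ r T).
  have [||x [y [u [xT yT nxy h]]]] := W q p r; rewrite 1?tri_swap //.
  exists x, y, u; split; [exact: etrans (mem3_swap _ _ _ _) xT |
    exact: etrans (mem3_swap _ _ _ _) yT | exact: nxy | exact: h].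
have [qr rp] := pos_triangle T p01.
have [npq nqr npr] := tri_neq T.
have mirror (x y z u : B) : tri x y z -> val u = val x + val y - val z -> tri u x y.
  case/and3P=> xy yz xz E; apply/and3P; split=> //; rewrite /adj E.
    exact: hex_adj_mirror.
  by rewrite [val x + _]addrC; apply: hex_adj_mirror.
have Tq : tri q r p by rewrite -tri_rot.
have Tr : tri r p q by rewrite tri_rot.
have := core_near (valP p) (valP q) (valP r) p01 qr rp.
have pin : p \in [:: p; q; r] by exact: mem_head.
have rin : r \in [:: p; q; r] by exact: (mem_last p [:: q; r]).
have qin : q \in [:: p; q; r] by rewrite in_cons mem_head orbT.
case/or4P=> [cp|cq|cr|/or3P[]/core_cell[u E iu]].
- by exists q, r, p; split=> //; rewrite interiorE.
- by exists p, r, q; split=> //; rewrite interiorE tri_swap.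
- by exists p, q, r; split=> //; rewrite interiorE.
- by exists p, q, u; split=> //; split=> //; exact: mirror T E.
- by exists q, r, u; split=> //; split=> //; exact: mirror Tq E.
exists r, p, u; split=> //; first by rewrite eq_sym.
by split=> //; exact: mirror Tr E.
Qed.
End BoardGeometry.

Section CoreCount.
Variables (B : board) (core : hex -> bool) (s : seq hex) (n0 n1 : hex).
Variable rank : hex -> nat.
Local Open Scope ring_scope.
Hypothesis core_sub : forall p, core p -> p \in B.
Hypothesis interiorE : forall v : B, interior v = core (val v).
Hypothesis core_near : forall p q r : hex, p \in B -> q \in B -> r \in B ->
  hex_pos p q -> hex_pos q r -> hex_pos r p ->
  [|| core p, core q, core r, core (p + q - r), core (q + r - p) | core (r + p - q)].
Hypotheses (core0 : core n0) (core1 : core n1) (adj01 : hex_adj n0 n1).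
Hypothesis core_descend : forall p, core p -> p != n0 ->
  exists p', [/\ core p', hex_adj p p' & (rank p' < rank p)%N].
Hypotheses (us : uniq s) (sB : {subset s <= B}).
Hypothesis far : forall p, p \in B ->
  (p \in s) = ~~ (core p || has (fun n => core (p + dir n)) (iota 0 6)).
Hypothesis few : forall p, p \in s -> exists x y,
  forall r, r \in B -> hex_adj p r -> r \in [:: x; y].
Hypothesis room : (4 + size s <= #|` B|)%N.

(** What the count needs of a board, in terms of coordinates only: the interior
cells are given by core and the acute corners by s. *)
Lemma card_components_core :
  #|non_isolated_components B 2| = (2 * (#|` B| - 2) ^_ (size s))%N.
Proof.
have [v0 E0 iv0] := core_cell core_sub interiorE core0.
have [v1 E1 iv1] := core_cell core_sub interiorE core1.
have v01 : adj v0 v1 by rewrite /adj E0 E1.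
have notin k : (k \in ~: covered B) = (val k \in s).
  by rewrite inE (coveredE core_sub interiorE) far //; exact: valP.
have cK : #|~: covered B| = size s by exact: card_val us sB notin.
have cI := cardsC (covered B); rewrite cK -cardfE in cI.
have descend u : interior u -> u != v0 ->
    exists u', [/\ interior u', adj u u' & (rank (val u') < rank (val u))%N].
  rewrite interiorE -(inj_eq val_inj) E0 => cu nu.
  have [p [cp ap rp]] := core_descend cu nu.
  by have [u' E' iu'] := core_cell core_sub interiorE cp; exists u'; rewrite /adj E'.
rewrite (card_components iv0 iv1 v01 descend); first by rewrite -cI addKn.
- exact: near_core core_sub interiorE core_near.
- move=> k; rewrite -in_setC notin => /few[x [y h]]; exact: corner_val h.
by rewrite -(leq_add2r (size s)) cI.
Qed.
End CoreCount.

Lemma interior_all (B : board) (v : B) :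
  interior v = all (fun n => (val v + dir n)%R \in B) (iota 0 6).
Proof.
apply/forallP/allP => [h n|h n]; last by apply: h; rewrite mem_iota ltn_ord.
by rewrite mem_iota /= => ltn; exact: (h (Ordinal ltn)).
Qed.

(** * The parallelogram and the triangle *)

Section Boards.
Local Open Scope ring_scope.

Definition core_par (m1 m2 : nat) (p : hex) :=
  (0 < p.1 < m1%:Z - 1) && (0 < p.2 < m2%:Z - 1).

Definition core_tri (m : nat) (p : hex) := (0 < p.2 < p.1) && (p.1 < m%:Z - 1).

Lemma interior_par m1 m2 (v : parallelogram m1 m2) :
  interior v = core_par m1 m2 (val v).
Proof.
rewrite interior_all /= !mem_parallelogram /core_par.
have := valP v; rewrite mem_parallelogram; case: (val v) => x y /=; lia.
Qed.

Lemma interior_tri m (v : triangle m) : interior v = core_tri m (val v).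
Proof.
rewrite interior_all /= !mem_triangle /core_tri.
have := valP v; rewrite mem_triangle; case: (val v) => x y /=; lia.
Qed.

Lemma near_par m1 m2 p q r : (3 <= m1)%N -> (3 <= m2)%N -> (4 <= maxn m1 m2)%N ->
  let core := core_par m1 m2 in
  p \in parallelogram m1 m2 -> q \in parallelogram m1 m2 -> r \in parallelogram m1 m2 ->
  hex_pos p q -> hex_pos q r -> hex_pos r p ->
  [|| core p, core q, core r, core (p + q - r), core (q + r - p) | core (r + p - q)].
Proof.
move=> h1 h2 h3 /=; rewrite !mem_parallelogram.
case: p q r => [a b] [c d] [e f]; rewrite !hex_posxy /core_par /= => Bp Bq Br.
case/or3P=> /andP[/eqP ? /eqP ?]; subst c d;
  case/or3P=> /andP[/eqP ? /eqP ?]; subst e f => rp.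
all: try (exfalso; clear -rp; lia).
all: clear rp; lia.
Qed.

Lemma near_tri m p q r : (5 <= m)%N ->
  let core := core_tri m in
  p \in triangle m -> q \in triangle m -> r \in triangle m ->
  hex_pos p q -> hex_pos q r -> hex_pos r p ->
  [|| core p, core q, core r, core (p + q - r), core (q + r - p) | core (r + p - q)].
Proof.
move=> h1 /=; rewrite !mem_triangle.
case: p q r => [a b] [c d] [e f]; rewrite !hex_posxy /core_tri /= => Bp Bq Br.
case/or3P=> /andP[/eqP ? /eqP ?]; subst c d;
  case/or3P=> /andP[/eqP ? /eqP ?]; subst e f => rp.
all: try (exfalso; clear -rp; lia).
all: clear rp; lia.
Qed.

Lemma parallelogram_count m1 m2 :
  (3 <= m1)%N -> (3 <= m2)%N -> (4 <= maxn m1 m2)%N ->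
  #|non_isolated_components (parallelogram m1 m2) 2|
    = (4 * 'C(m1 * m2 - 2, 2))%N.
Proof.
move=> h1 h2 h3.
have -> : (4 * 'C(m1 * m2 - 2, 2) = 2 * (#|` parallelogram m1 m2| - 2) ^_ 2)%N.
  by rewrite card_parallelogram -bin_ffact (erefl : factorial 2 = 2%N); lia.
pose s : seq hex := [:: (0, m2%:Z - 1); (m1%:Z - 1, 0)].
pose v1 : hex := if (3 < m1)%N then (2, 1) else (1, 2).
apply: (@card_components_core _ (core_par m1 m2) s (1, 1) v1
  (fun p => `|p.1| + `|p.2|)%N).
- by move=> [x y]; rewrite mem_parallelogram /core_par /=; lia.
- exact: interior_par.
- by move=> p q r; exact: near_par.
- by rewrite /core_par /=; lia.
- by rewrite /v1 /core_par; case: ifP => /=; lia.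
- by rewrite /v1; case: ifP.
- move=> [x y] cp np; exists (if 1 < x then (x - 1, y) else (x, y - 1)).
  move: cp np; rewrite /core_par xpair_eqE /=.
  by case: ifP => hx cp np; rewrite hex_adjxy /=; split; lia.
- by rewrite /= inE xpair_eqE; lia.
- by move=> p; rewrite !inE mem_parallelogram => /orP[]/eqP-> /=; lia.
- move=> [x y]; rewrite mem_parallelogram !inE !xpair_eqE /core_par /= => h.
  rewrite !negb_or; apply/idP/idP.
    by case/orP=> /andP[/eqP-> /eqP->]; lia.
  (* x = 0, x = m1 - 1 or neither, and likewise for y *)
  by move: h; case: (eqVneq x 0) => [->|x0];
    [|case: (eqVneq x (m1%:Z - 1)) => [->|x1]];
    (case: (eqVneq y 0) => [->|y0];
      [|case: (eqVneq y (m2%:Z - 1)) => [->|y1]]); lia.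
- move=> p; rewrite !inE => /orP[]/eqP->.
    exists (1, m2%:Z - 1), (0, m2%:Z - 2) => -[x y].
    by rewrite mem_parallelogram hex_adjxy !inE !xpair_eqE /=; lia.
  exists (m1%:Z - 2, 0), (m1%:Z - 1, 1) => -[x y].
  by rewrite mem_parallelogram hex_adjxy !inE !xpair_eqE /=; lia.
by rewrite card_parallelogram /=; nia.
Qed.

Lemma triangle_count m : (5 <= m)%N ->
  #|non_isolated_components (triangle m) 2|
    = (12 * 'C((m * (m + 1)) %/ 2 - 2, 3))%N.
Proof.
move=> h1.
have -> : (12 * 'C((m * (m + 1)) %/ 2 - 2, 3) = 2 * (#|` triangle m| - 2) ^_ 3)%N.
  by rewrite card_triangle -bin_ffact (erefl : factorial 3 = 6%N); lia.
pose s : seq hex := [:: (0, 0); (m%:Z - 1, 0); (m%:Z - 1, m%:Z - 1)].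
apply: (@card_components_core _ (core_tri m) s (2, 1) (3, 1)
  (fun p => `|p.1| + `|p.2|)%N).
- by move=> [x y]; rewrite mem_triangle /core_tri /=; lia.
- exact: interior_tri.
- by move=> p q r; exact: near_tri.
- by rewrite /core_tri /=; lia.
- by rewrite /core_tri /=; lia.
- by [].
- move=> [x y] cp np; exists (if 1 < y then (x - 1, y - 1) else (x - 1, y)).
  move: cp np; rewrite /core_tri xpair_eqE /=.
  by case: ifP => hx cp np; rewrite hex_adjxy /=; split; lia.
- by rewrite /= !inE !xpair_eqE; lia.
- by move=> p; rewrite !inE mem_triangle => /or3P[]/eqP-> /=; lia.
- move=> [x y]; rewrite mem_triangle !inE !xpair_eqE /core_tri /= => h.
  rewrite !negb_or; apply/idP/idP.
    by case/or3P=> /andP[/eqP-> /eqP->]; lia.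
  (* y = 0, y = x or neither, and x = m - 1 or not *)
  by move: h; case: (eqVneq y 0) => [->|y0];
    [|case: (eqVneq y x) => [yx|yx]];
    (case: (eqVneq x (m%:Z - 1)) => [->|x1]); lia.
- move=> p; rewrite !inE => /or3P[]/eqP->.
  + exists (1, 0), (1, 1) => -[x y].
    by rewrite mem_triangle hex_adjxy !inE !xpair_eqE /=; lia.
  + exists (m%:Z - 2, 0), (m%:Z - 1, 1) => -[x y].
    by rewrite mem_triangle hex_adjxy !inE !xpair_eqE /=; lia.
  exists (m%:Z - 2, m%:Z - 2), (m%:Z - 1, m%:Z - 2) => -[x y].
  by rewrite mem_triangle hex_adjxy !inE !xpair_eqE /=; lia.
by rewrite card_triangle /= leq_divRL //; nia.
Qed.
End Boards.


Theorem theorem1p9 :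
  (forall m1 m2 : nat,
     3 <= m1 -> 3 <= m2 -> 4 <= maxn m1 m2 ->
     #|non_isolated_components (parallelogram m1 m2) 2| =
       4 * 'C(m1 * m2 - 2, 2)) /\
  (forall m : nat,
     5 <= m ->
     #|non_isolated_components (triangle m) 2| =
       12 * 'C((m * (m + 1)) %/ 2 - 2, 3)).
Proof.
by split=> [m1 m2|m]; [exact: parallelogram_count | exact: triangle_count].
Qed.
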